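(* Let $1\le p<\infty$, $X=\ell_p(\mathbb Z_+)$, and let $\mathbf u,\mathbf v$ be bounded sequences of non-zero scalars. Assume that either $$\liminf_{n\to\infty}\max_{0\le d\le N}\left|\frac{u_1\cdots u_{n+d}}{v_1\cdots v_{n+d}}\right|=0\quad\text{for all }N\ge0,$$ or $$\limsup_{n\to\infty}\min_{0\le d\le N}\left|\frac{u_1\cdots u_{n+d}}{v_1\cdots v_{n+d}}\right|=\infty\quad\text{for all }N\ge0.$$ Then $B_{\mathbf u}$ and $B_{\mathbf v}$ are orthogonal.
   Context: $(e_n)_{n\ge0}$ is the canonical basis of $\ell_p(\mathbb Z_+)$ (real or complex). For a bounded sequence $\mathbf w$ of non-zero scalars, $B_{\mathbf w}e_0=0$, $B_{\mathbf w}e_n=w_ne_{n-1}$. Two operators $T_1,T_2$ on $X$ are orthogonal if whenever $m_1,m_2$ are Borel probability measures invariant under $T_1$, $T_2$ respectively (i.e. $m_i(T_i^{-1}A)=m_i(A)$ for Borel $A$) with $m_1(\{0\})=0=m_2(\{0\})$, then $m_1$ and $m_2$ are mutually singular. *)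

(* Defs.v *)
From HB Require Import structures.
From mathcomp Require Import all_boot all_order all_algebra.
From mathcomp Require Import all_classical all_reals all_analysis.
From mathcomp.real_closed Require Import complex.

Set Implicit Arguments.
Unset Strict Implicit.
Unset Printing Implicit Defensive.
Import Order.TTheory GRing.Theory Num.Theory.
Local Open Scope classical_set_scope.
Local Open Scope ring_scope.

(* Scalars: a field [K] (R for real scalars, R[i] for complex scalars)
   equipped with its absolute value [nrm : K -> R]. Sequences x : nat -> K,
   x n being the coordinate on e_n. The space X = l_p(Z_+) is the set
   [lp_mem p] of p-summable sequences, inside the ambient type nat -> K. *)

Section Lp.
Variables (R : realType) (K : fieldType) (nrm : K -> R).

Definition lp_mem (p : R) : set (nat -> K) :=
  [set x | (\sum_(0 <= n <oo) ((nrm (x n)) `^ p)%:E < +oo)%E].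

Definition lp_dist (p : R) (x y : nat -> K) : R :=
  (fine (\sum_(0 <= n <oo) ((nrm (x n - y n)) `^ p)%:E)) `^ p^-1.

Definition lp_open (p : R) (U : set (nat -> K)) : Prop :=
  U `<=` lp_mem p /\
  forall x, U x -> exists2 e : R, 0 < e &
    forall y, lp_mem p y -> lp_dist p x y < e -> U y.

Definition lp_borel (p : R) : set (set (nat -> K)) :=
  <<s lp_mem p, lp_open p >>.

(* m is a Borel probability measure on X (values off Borel sets irrelevant) *)
Definition is_borel_prob (p : R) (m : set (nat -> K) -> \bar R) : Prop :=
  [/\ m set0 = 0%E,
      (forall A, lp_borel p A -> (0 <= m A)%E),
      (forall F : nat -> set (nat -> K), (forall n, lp_borel p (F n)) ->
         trivIset setT F ->
         (fun n => \sum_(0 <= k < n) m (F k))%E @ \oo --> m (\bigcup_n F n)) &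
      m (lp_mem p) = 1%E].

(* m is op_invariant under T (an operator of X, given on the ambient type):
   m (T^{-1} A) = m A for Borel A, with T^{-1} A taken inside X *)
Definition op_invariant (p : R) (T : (nat -> K) -> (nat -> K))
    (m : set (nat -> K) -> \bar R) : Prop :=
  forall A, lp_borel p A -> m (lp_mem p `&` (T @^-1` A)) = m A.

Definition mutually_singular (p : R) (m1 m2 : set (nat -> K) -> \bar R) : Prop :=
  exists A, [/\ lp_borel p A, m1 A = 0%E & m2 (lp_mem p `\` A) = 0%E].

Definition op_orthogonal (p : R) (T1 T2 : (nat -> K) -> (nat -> K)) : Prop :=
  forall m1 m2 : set (nat -> K) -> \bar R,
    is_borel_prob p m1 -> is_borel_prob p m2 ->
    op_invariant p T1 m1 -> op_invariant p T2 m2 ->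
    m1 [set (fun _ => 0)] = 0%E -> m2 [set (fun _ => 0)] = 0%E ->
    mutually_singular p m1 m2.

(* weighted backward shift: B_w e_0 = 0, B_w e_n = w_n e_{n-1}, i.e.
   (B_w x)_n = w_{n+1} x_{n+1}.  Weights are w 1, w 2, ... (w 0 unused). *)
Definition bshift (w : nat -> K) (x : nat -> K) : nat -> K :=
  fun n => w n.+1 * x n.+1.

Definition good_weight (w : nat -> K) : Prop :=
  (forall n, (0 < n)%N -> w n != 0) /\
  exists M : R, forall n, (0 < n)%N -> nrm (w n) <= M.

Definition wratio (u v : nat -> K) (n : nat) : R :=
  nrm ((\prod_(1 <= i < n.+1) u i) / (\prod_(1 <= i < n.+1) v i)).

Definition hyp_liminf (u v : nat -> K) : Prop :=
  forall N : nat,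
    limn_einf (fun n => (\big[Num.max/0]_(0 <= d < N.+1) wratio u v (n + d))%:E)
    = 0%E.

Definition hyp_limsup (u v : nat -> K) : Prop :=
  forall N : nat,
    limn_esup (fun n => (\big[Num.min/wratio u v n]_(0 <= d < N.+1)
                           wratio u v (n + d))%:E)
    = +oo%E.

End Lp.

Definition cmod (R : realType) (z : R[i]) : R :=
  Num.sqrt (complex.Re z ^+ 2 + complex.Im z ^+ 2).

(* Main.v *)
Require Import Defs.
From HB Require Import structures.
From mathcomp Require Import all_boot all_order all_algebra.
From mathcomp Require Import all_classical all_reals all_analysis.
From mathcomp.real_closed Require Import complex.
From mathcomp Require Import lra.
Import Order.TTheory GRing.Theory Num.Theory.
Local Open Scope ring_scope.

(* Write W_n = w_1 ... w_n. Under a B_w-invariant probability the coordinates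
   satisfy: (W_(n+d) x_(n+d))_(d <= N) has the law of (W_d x_d)_(d <= N), for
   every n. Given e > 0, since m1({0}) = 0 there are N and c > 0 such that
   max_(d <= N) |U_(n+d) x_(n+d)| > c has m1-probability >= 1 - e for all n;
   and there is M such that max_(d <= N) |V_(n+d) x_(n+d)| > M has
   m2-probability <= e for all n. If |U_(n+d) / V_(n+d)| <= c / M for all
   d <= N, the first event is contained in the second, so it has
   m1-probability >= 1 - e and m2-probability <= e. Borel-Cantelli then gives
   mutual singularity. The limsup hypothesis is the liminf one with u and v
   exchanged, and orthogonality is symmetric. *)

Lemma sigma_algebra_subset {T : Type} {D : set T} {G : set (set T)} :
  (G `<=` [set A | A `<=` D] -> <<s D, G >> `<=` [set A | A `<=` D])%classic.
Proof.
move=> GD; apply: smallest_sub => //; split => /=; first exact: sub0set.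
- by move=> ? _; exact: subDsetl.
- by move=> F FD; exact: bigcup_sub.
Qed.

(** * Probability measures on a sigma-algebra of subsets of [D] *)

Section ProbabilityOnSubset.
Set Implicit Arguments.
Unset Strict Implicit.
Local Open Scope classical_set_scope.
Local Open Scope ereal_scope.
Variables (R : realType) (T : pointedType) (D : set T) (G : set (set T)).
Hypothesis subGD : G `<=` [set A | A `<=` D].

Local Notation B := <<s D, G >>.

Let B_sub A : B A -> A `<=` D := @sigma_algebra_subset _ D G subGD A.

Let B_D A : B A -> D `&` A = A.
Proof. by move=> /B_sub AD; exact/setIidPr. Qed.

(** Extends the sigma-algebra from [D] to the whole type, so that general measure theory on a
    measurable type applies; the sets already in it keep the same trace. *)
Definition trace_sets : set (set T) := [set A | <<s D, G >> (D `&` A)].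

Lemma sigma_algebra_trace : sigma_algebra setT trace_sets.
Proof.
split; rewrite /trace_sets /=.
- by rewrite setI0; exact: sigma_algebra0.
- move=> A BA; have -> : D `&` (setT `\` A) = D `\` (D `&` A).
    by rewrite setTD setDIr setDv set0U setDE.
  exact: sigma_algebraCD.
- by move=> F BF; rewrite setI_bigcupr; exact: sigma_algebra_bigcup.
Qed.

Let TT := g_sigma_algebraType trace_sets.

Let mE (A : set TT) : measurable A = <<s D, G >> (D `&` A).
Proof.
by rewrite (measurable_g_measurableTypeE sigma_algebra_trace).
Qed.

Let mB (A : set TT) : B A -> measurable A.
Proof. by move=> BA; rewrite mE B_D. Qed.

Let B_lim_sup (F : (set T)^nat) : (forall n, B (F n)) -> B (lim_sup_set F).
Proof.
move=> BF; have : measurable (lim_sup_set F : set TT).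
  by apply: bigcap_measurable => // n _; apply: bigcup_measurable => j _; exact: mB.
rewrite mE (_ : D `&` _ = lim_sup_set F)//; apply/setIidPr.
(* The intersection of the tail unions lies in the tail union from 0, which is contained in [D]. *)
by apply: (@subset_trans _ (\bigcup_(j >= 0) F j));
  [exact: bigcap_inf|apply: bigcup_sub => n _; exact: B_sub].
Qed.

Definition sub_prob (m : set T -> \bar R) : Prop :=
  [/\ m set0 = 0, (forall A, <<s D, G >> A -> 0 <= m A),
      (forall F : (set T)^nat, (forall n, <<s D, G >> (F n)) ->
         trivIset setT F ->
         (fun n => \sum_(0 <= k < n) m (F k)) @ \oo --> m (\bigcup_n F n)) &
      m D = 1].

Section Measure.
Variables (m : set T -> \bar R) (pm : sub_prob m).

(** The values of [m] off the sigma-algebra are arbitrary, possibly negative; the default 0 makes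
    the function nonnegative on every set. The proof argument lets the measure instance depend on
    [sub_prob m]. *)
Definition trace_measure of sub_prob m : set TT -> \bar R := fun A =>
  if `[< <<s D, G >> (D `&` A) >] then m (D `&` A) else 0.

Local Notation mu := (trace_measure pm).

Let muE A : measurable A -> mu A = m (D `&` A).
Proof. by rewrite mE /trace_measure; case: asboolP. Qed.

Let mu0 : mu set0 = 0.
Proof. by rewrite muE// setI0; case: pm. Qed.

Let mu_ge0 A : 0 <= mu A.
Proof.
by rewrite /trace_measure; case: asboolP => // BA; case: pm => _ + _ _; apply.
Qed.

Let mu_sigma_additive : semi_sigma_additive mu.
Proof.
move=> F mF tF mUF; rewrite muE// setI_bigcupr.
have -> : (fun n => \sum_(0 <= i < n) mu (F i)) =
          (fun n => \sum_(0 <= i < n) m (D `&` F i)).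
  by apply/funext => n; apply: eq_bigr => i _; exact: muE.
case: pm => _ _ + _; apply => [n|]; first by have := mF n; rewrite mE.
exact: trivIset_setIl.
Qed.

HB.instance Definition _ := isMeasure.Build _ _ _ mu
  mu0 mu_ge0 mu_sigma_additive.

Let mu_B A : B A -> mu A = m A.
Proof. by move=> BA; rewrite muE ?B_D//; exact: mB. Qed.

Let mu_C A : B A -> mu (~` A) = m (D `\` A).
Proof. by move=> BA; rewrite muE ?setDE//; apply: measurableC; exact: mB. Qed.

Let mu_T : mu setT = 1.
Proof. by rewrite muE// setIT; case: pm. Qed.

(** Continuity from above: the complements decrease to a null set, so their measures tend to 0. *)
Lemma sub_prob_exhaust (F : (set T)^nat) (e : R) : (0 < e)%R ->
  (forall n, <<s D, G >> (F n)) -> nondecreasing_seq F ->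
  m (D `\` \bigcup_n F n) = 0 -> exists n, m (D `\` F n) <= e%:E.
Proof.
move=> e0 BF ndF mF0.
have mF n : measurable (F n : set TT) by exact: (mB (BF n)).
have BU : B (\bigcup_n F n) by exact: sigma_algebra_bigcup.
have cvC : mu \o (fun n => ~` F n) @ \oo --> mu (\bigcap_n ~` F n).
  apply: nonincreasing_cvg_mu => //=.
  - apply: (@le_lt_trans _ _ (mu setT)); last by rewrite mu_T ltry.
    by apply: le_measure; rewrite ?inE; [apply: measurableC; exact: mF|exact: measurableT|exact: subsetT].
  - by move=> n; apply: measurableC; exact: mF.
  - by apply: bigcapT_measurable => n; apply: measurableC; exact: mF.
  - by move=> i j ij; rewrite subsetEset; apply: subsetC; rewrite -subsetEset; exact: ndF.
move: cvC; rewrite -setC_bigcup mu_C// mF0 => /fine_cvgP[fin].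
move=> /cvgrPdist_lt /(_ e e0) cv; near \oo => n.
exists n; rewrite -mu_C//.
have fn : mu (~` F n) \is a fin_num by near: n; exact: fin.
rewrite -(fineK fn) lee_fin ltW//.
suff : (`|0 - (fine \o (mu \o (fun k => ~` F k))) n| < e)%R.
  by rewrite sub0r normrN /=; exact/le_lt_trans/ler_norm.
by near: n.
Unshelve. all: by end_near. Qed.

Lemma sub_prob_setD A : <<s D, G >> A -> m (D `\` A) = 1 - m A.
Proof.
move=> BA; rewrite -(mu_C BA) -(mu_B BA) -setTD.
have tl : mu setT < +oo by rewrite mu_T ltry.
by rewrite (measureD measurableT (mB BA) tl) setTI -mu_T.
Qed.

Lemma sub_prob_le A A' : <<s D, G >> A -> <<s D, G >> A' ->
  A `<=` A' -> m A <= m A'.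
Proof.
move=> BA BA' AA'; rewrite -(mu_B BA) -(mu_B BA').
by apply: le_measure => //; rewrite ?inE; exact: mB.
Qed.

(** Borel-Cantelli: the geometric bounds have sum at most 1, so the measures are summable. *)
Lemma sub_prob_lim_sup (F : (set T)^nat) :
  (forall n, <<s D, G >> (F n)) -> (forall n, m (F n) <= (1 / (2 ^ n.+1)%:R)%:E) ->
  m (lim_sup_set F) = 0.
Proof.
move=> BF F2.
have mF n : measurable (F n : set TT) by exact: (mB (BF n)).
rewrite -(mu_B (B_lim_sup BF)); apply: lim_sup_set_cvg0 => //.
apply: (@le_lt_trans _ _ 1); last exact: ltry.
apply: le_trans (@epsilon_trick0 R 1 xpredT ler01).
by apply: lee_nneseries => [n _ _|n _]; [exact: mu_ge0|by have := F2 n; rewrite -(mu_B (BF n))].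
Qed.

End Measure.

(* Borel-Cantelli applied to [F n] under [m2] and to its complement under [m1]. *)
Lemma sub_prob_singular (m1 m2 : set T -> \bar R) :
  sub_prob m1 -> sub_prob m2 ->
  (forall e : R, (0 < e)%R ->
    exists A, [/\ <<s D, G >> A, m1 (D `\` A) <= e%:E & m2 A <= e%:E]) ->
  exists A, [/\ <<s D, G >> A, m1 A = 0 & m2 (D `\` A) = 0].
Proof.
move=> p1 p2 small.
have e0 n : (0 < 1 / (2 ^ n.+1)%:R :> R)%R by rewrite divr_gt0// ltr0n expn_gt0.
have [F FP] := choice (fun n => small _ (e0 n)).
have BF n : B (F n) by case: (FP n).
have BC n : B (D `\` F n) by exact: sigma_algebraCD.
have z2 : m2 (lim_sup_set F) = 0.
  by apply: (sub_prob_lim_sup p2 BF) => n; case: (FP n).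
have z1 : m1 (lim_sup_set (fun n => D `\` F n)) = 0.
  by apply: (sub_prob_lim_sup p1 BC) => n; case: (FP n).
exists (D `\` lim_sup_set F); split; first exact: (sigma_algebraCD (B_lim_sup BF)).
- apply/eqP; rewrite eq_le; apply/andP; split; last first.
    by case: p1 => _ + _ _; apply; exact: (sigma_algebraCD (B_lim_sup BF)).
  rewrite -z1; apply: sub_prob_le => //; [exact: (sigma_algebraCD (B_lim_sup BF))|exact: (B_lim_sup BC)|].
  (* If [x] were in [F k] for all [k >= n], every tail union would contain it, through the index
     [maxn n k]. *)
  move=> x [Dx nx] n _; have [k nk nFx] : exists2 k, (n <= k)%N & ~ F k x.
    apply: contra_notP nx => H k _; exists (maxn n k) => /=; first exact: leq_maxr.
    by apply: contrapT => nF; apply: H; exists (maxn n k) => //; exact: leq_maxl.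
  by exists k.
- by rewrite setDD (B_D (B_lim_sup BF)).
Qed.

End ProbabilityOnSubset.

(** * Weighted shifts on the sequence space, for an abstract absolute value *)

Section WeightedShift.
Set Implicit Arguments.
Unset Strict Implicit.
Local Open Scope classical_set_scope.
Variables (R : realType) (K : fieldType) (nrm : K -> R).
Hypothesis nrm_ge0 : forall x, 0 <= nrm x.
Hypothesis nrm_eq0 : forall x, (nrm x == 0) = (x == 0).
Hypothesis nrmM : forall x y, nrm (x * y) = nrm x * nrm y.
Hypothesis nrmD : forall x y, nrm (x + y) <= nrm x + nrm y.
Hypothesis nrmN : forall x, nrm (- x) = nrm x.
Variables (p : R) (p1 : 1 <= p).

Local Notation X := (lp_mem nrm p).
Local Notation wprod w n := (\prod_(1 <= i < n.+1) w i).

Let p_gt0 : 0 < p. Proof. exact: lt_le_trans p1. Qed.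

Let powE_ge0 (x : nat -> R) i : (0 <= ((x i) `^ p)%:E)%E.
Proof. by rewrite lee_fin powR_ge0. Qed.

Let powR_mono x y : 0 <= x -> x <= y -> x `^ p <= y `^ p.
Proof.
move=> x0 xy; apply: ge0_ler_powR; rewrite ?nnegrE//; first exact: ltW.
exact: le_trans xy.
Qed.

Lemma lp_memB x y : X x -> X y -> X (fun n => x n - y n).
Proof.
rewrite /lp_mem /= => Xx Xy.
(* Termwise, [(a + b) ^ p <= (2 max(a, b)) ^ p <= 2 ^ p (a ^ p + b ^ p)]. *)
apply: (@le_lt_trans _ _ (\sum_(0 <= n <oo)
  ((2 `^ p)%:E * (((nrm (x n)) `^ p)%:E + ((nrm (y n)) `^ p)%:E)))%E).
  apply: lee_nneseries => [i _ _|i _]; first exact: (powE_ge0 (fun n => nrm _)).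
  rewrite -EFinD -EFinM lee_fin.
  set a := nrm (x i); set b := nrm (y i).
  have a0 : 0 <= a := nrm_ge0 _. have b0 : 0 <= b := nrm_ge0 _.
  have ab : nrm (x i - y i) <= a + b by rewrite (le_trans (nrmD _ _))// nrmN.
  have m0 : 0 <= Num.max a b by rewrite le_max a0.
  apply: (@le_trans _ _ ((2 * Num.max a b) `^ p)).
    apply: powR_mono => //; apply: (le_trans ab).
    by rewrite mulr2n mulrDl mul1r lerD// le_max lexx ?orbT.
  rewrite powRM// ler_wpM2l ?powR_ge0//.
  by case: (leP a b) => _; rewrite ?lerDl ?lerDr powR_ge0.
rewrite nneseriesZl => [|i _]; last by rewrite adde_ge0 ?lee_fin ?powR_ge0.
rewrite nneseriesD => [||]; do ?by move=> *; rewrite lee_fin powR_ge0.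
by rewrite lte_mul_pinfty ?lee_fin ?powR_ge0// lte_add_pinfty.
Qed.

(** A single term of a nonnegative series is at most its sum; then take p-th roots. This continuity
    of the coordinates makes the sets [window] open. *)
Lemma lp_dist_coord x y k : X x -> X y -> nrm (x k - y k) <= lp_dist nrm p x y.
Proof.
move=> Xx Xy; have Xxy := lp_memB Xx Xy; rewrite /lp_mem /= in Xxy.
rewrite /lp_dist; set s := (X in fine X).
have s0 : (0 <= s)%E.
  by apply: nneseries_ge0 => i _ _; exact: (powE_ge0 (fun n => nrm _)).
have sfin : s \is a fin_num by rewrite ge0_fin_numE.
have ks : (nrm (x k - y k)) `^ p <= fine s.
  rewrite -lee_fin fineK// /s (@nneseriesD1 _ _ k xpredT)//; last first.
    by move=> i _; exact: (powE_ge0 (fun n => nrm _)).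
  by rewrite leeDl//; apply: nneseries_ge0 => i _ _; exact: (powE_ge0 (fun n => nrm _)).
rewrite -[leLHS](powRr1 (nrm_ge0 _)) -(@mulfV _ p) ?gt_eqF// powRrM.
apply: ge0_ler_powR => //; rewrite ?nnegrE ?powR_ge0 ?fine_ge0//.
by rewrite invr_ge0 ltW.
Qed.

Lemma lp_mem_bshift w x : good_weight nrm w -> X x -> X (bshift w x).
Proof.
move=> [_ [M wM]]; rewrite /lp_mem /= => Xx.
have M0 : 0 <= M by exact: (le_trans (nrm_ge0 (w 1%N)) (wM 1%N isT)).
apply: (@le_lt_trans _ _
    (\sum_(0 <= n <oo) ((M `^ p)%:E * ((nrm (x (n + 1)%N)) `^ p)%:E))%E).
  apply: lee_nneseries => [i _ _|i _]; first exact: (powE_ge0 (fun n => nrm _)).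
  rewrite -EFinM lee_fin -powRM// addn1; apply: powR_mono => //.
  by rewrite /bshift nrmM ler_wpM2r// wM.
rewrite nneseriesZl => [|i _]; last by rewrite lee_fin powR_ge0.
rewrite lte_mul_pinfty ?lee_fin ?powR_ge0//.
(* The shifted series is the series of [x] without its term of index 0. *)
rewrite (nneseries_addn 1 (fun i => powE_ge0 (fun n => nrm (x n)) i)).
apply: le_lt_trans Xx; rewrite [leRHS]nneseries_recl//.
  by rewrite leeDr// lee_fin powR_ge0.
by move=> i _; rewrite lee_fin powR_ge0.
Qed.

(** The event that the maximum over [d <= N] of the normalised coordinates exceeds [c], written with
    an existential so that it is visibly a union of open conditions on single coordinates. *)
Definition window (w : nat -> K) (N : nat) (c : R) (n : nat) : set (nat -> K) :=
  [set x | X x /\ exists2 d, (d <= N)%N & c < nrm (wprod w (n + d)%N * x (n + d)%N)].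

Lemma window_open w N c n : lp_open nrm p (window w N c n).
Proof.
split=> [x []//|x [Xx [d dN cx]]].
set k := (n + d)%N in cx; set a := wprod w k in cx.
have a1 : 0 < nrm a + 1 by rewrite ltr_wpDl.
(* Moving [x k] by less than this changes [nrm (a * x k)] by less than its excess over [c]; the
   [+ 1] keeps the denominator positive even if [a = 0]. *)
exists ((nrm (a * x k) - c) / (nrm a + 1)); first by rewrite divr_gt0 ?subr_gt0.
move=> y Xy; rewrite ltr_pdivlMr// => dxy; split => //; exists d => //.
rewrite -/k -/a.
have : nrm (a * x k) <= nrm a * nrm (x k - y k) + nrm (a * y k).
  by rewrite -nrmM; apply: le_trans (nrmD _ _); rewrite -mulrDr subrK.
have := lp_dist_coord k Xx Xy; have := nrm_ge0 a; have := nrm_ge0 (x k - y k).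
move: dxy; set D := lp_dist _ _ _ _; set A := nrm a; set B := nrm (x k - y k).
nra.
Qed.

Lemma window_borel w N c n : lp_borel nrm p (window w N c n).
Proof. by apply: sub_sigma_algebra; exact: window_open. Qed.

(* The n-fold shift scales [x (n + d)] by [wprod w (n + d) / wprod w d], so the
   weight products absorb the iteration. *)
Lemma bshift_window w N c n : good_weight nrm w ->
  X `&` (bshift w @^-1` window w N c n) = window w N c n.+1.
Proof.
move=> gw.
have E x d : wprod w (n + d)%N * bshift w x (n + d)%N =
             wprod w (n.+1 + d)%N * x (n.+1 + d)%N.
  by rewrite /bshift mulrA addSn [in RHS]big_nat_recr.
apply/seteqP; split => x /=.
  by move=> [Xx [_ [d dN]]]; rewrite E => cd; split => //; exists d.
move=> [Xx [d dN cd]]; split => //; split; first exact: lp_mem_bshift.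
by exists d => //; rewrite E.
Qed.

Lemma op_invariant_window w N c n (m : set (nat -> K) -> \bar R) :
  good_weight nrm w -> op_invariant nrm p (bshift w) m ->
  m (window w N c n) = m (window w N c 0).
Proof.
move=> gw inv; elim: n => // n <-.
by rewrite -(bshift_window N c n gw) inv//; exact: window_borel.
Qed.


(** Common form of the two hypotheses, the second with [u] and [v] exchanged. A single [n] for each
    [N] and [e] suffices, since window probabilities do not depend on [n]. *)
Definition vanishing_ratio (u v : nat -> K) : Prop :=
  forall (N : nat) (e : R), 0 < e -> exists n, forall d, (d <= N)%N ->
    nrm (wprod u (n + d)%N) <= e * nrm (wprod v (n + d)%N).

Let seqPointed : pointedType :=
  HB.pack_for pointedType (nat -> K)
    (gen_eqMixin (nat -> K)) (gen_choiceMixin (nat -> K)) (isPointed.Build (nat -> K) (fun=> 0)).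

Let lp_open_sub : lp_open nrm p `<=` [set A | A `<=` X].
Proof. by move=> A []. Qed.

Let nrm_gt0 x : x != 0 -> 0 < nrm x.
Proof. by move=> x0; rewrite lt_neqAle nrm_ge0 eq_sym nrm_eq0 x0. Qed.

Lemma wprod_neq0 w n : good_weight nrm w -> wprod w n != 0.
Proof.
move=> [w0 _]; rewrite big_nat prodf_seq_neq0; apply/allP => i _.
by apply/implyP => /andP[i0 _]; exact: w0.
Qed.

Lemma lp_mem0 : X (fun=> 0).
Proof.
rewrite /lp_mem /= eseries0 ?ltry// => i _ _.
have /eqP -> : nrm 0 == 0 by rewrite nrm_eq0.
by rewrite powR0// gt_eqF.
Qed.

(** As the weight products are non-zero, a non-zero coordinate of [x] gives a positive normalised
    one. The index [N] controls both length and threshold, so it must exceed the position [d] and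
    make [1 / (N + 1)] small: hence [maxn k d] below. *)
Lemma bigcup_window w : good_weight nrm w ->
  \bigcup_N window w N N.+1%:R^-1 0 = X `\` [set (fun=> 0)].
Proof.
move=> gw; apply/seteqP; split => x.
  move=> [N _ [Xx [d _ cd]]]; split => // x0; move: cd; rewrite x0 mulr0.
  have /eqP -> : nrm 0 == 0 by rewrite nrm_eq0.
  by rewrite ltNge invr_ge0 ler0n.
move=> [Xx x0]; have [d xd] : exists d, x d != 0.
  apply: contra_notP x0 => nx; apply/funext => d.
  by apply: contrapT => /eqP xd; apply: nx; exists d.
have a0 : 0 < nrm (wprod w d * x d).
  by rewrite nrm_gt0// mulf_neq0// wprod_neq0.
have [k _ ak] := near_infty_natSinv_lt (PosNum a0).
exists (maxn k d) => //; split => //; exists d; first exact: leq_maxr.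
rewrite add0n; apply: ak => /=; exact: leq_maxl.
Qed.

Lemma nondecreasing_window w : nondecreasing_seq (fun N => window w N N.+1%:R^-1 0).
Proof.
move=> M N MN; rewrite subsetEset => x [Xx [d dM cd]]; split => //; exists d.
  exact: leq_trans MN.
by apply: le_lt_trans cd; rewrite lef_pV2 ?posrE ?ltr0n// ler_nat.
Qed.

Lemma bigcup_windowC w N :
  \bigcup_k (X `\` window w N k.+1%:R 0) = X.
Proof.
apply/seteqP; split => x; first by move=> [k _ []].
(* The window is finite, so the sum of its normalised coordinates bounds each of them. *)
move=> Xx; pose s := \sum_(0 <= d < N.+1) nrm (wprod w d * x d).
exists (Num.truncn s) => //; split => // -[_ [d dN]].
rewrite add0n ltNge => /negP; apply.
have /ltW sT : s < (Num.truncn s).+1%:R by exact: truncnS_gt.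
apply: (le_trans _ sT); rewrite [leRHS](bigD1_seq d) ?iota_uniq ?mem_index_iota//=.
by rewrite lerDl sumr_ge0.
Qed.

Lemma window_sub u v N c M n : 0 < c -> 0 < M ->
  (forall d, (d <= N)%N ->
     nrm (wprod u (n + d)%N) <= c / M * nrm (wprod v (n + d)%N)) ->
  window u N c n `<=` window v N M n.
Proof.
move=> c0 M0 uv x [Xx [d dN cx]]; split => //; exists d => //.
have {cx} : c < c / M * nrm (wprod v (n + d)%N) * nrm (x (n + d)%N).
  by apply: (lt_le_trans cx); rewrite nrmM ler_wpM2r// uv.
by rewrite -2!mulrA -nrmM -{1}(mulr1 c) ltr_pM2l// mulrC ltr_pdivlMr// mul1r.
Qed.

Lemma orthogonal_of_vanishing_ratio u v :
  good_weight nrm u -> good_weight nrm v -> vanishing_ratio u v ->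
  op_orthogonal nrm p (bshift u) (bshift v).
Proof.
move=> gu gv uv m1 m2 pm1 pm2 inv1 inv2 m10 m20.
apply: (@sub_prob_singular _ seqPointed X (lp_open nrm p) lp_open_sub) => // e e0.
have bor w N c n : lp_borel nrm p (window w N c n) := window_borel w N c n.
have XB : lp_borel nrm p X.
  by rewrite -[X]setD0; apply: sigma_algebraCD; exact: sigma_algebra0.
have [N m1N] : exists N, (m1 (X `\` window u N N.+1%:R^-1 0) <= e%:E)%E.
  apply: (@sub_prob_exhaust _ seqPointed X _ lp_open_sub m1 pm1
    (fun N => window u N N.+1%:R^-1 0)) => //=; [by move=> ?; exact: bor|exact: nondecreasing_window|].
  (* What the windows miss is exactly the zero sequence, which is [m1]-null. *)
  rewrite bigcup_window// setDD setIidr// => _ ->.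
  exact: lp_mem0.
have [k m2k] : exists k,
    (m2 (X `\` (X `\` window v N k.+1%:R 0)) <= e%:E)%E.
  apply: (@sub_prob_exhaust _ seqPointed X _ lp_open_sub m2 pm2
    (fun k => X `\` window v N k.+1%:R 0)) => //.
  - by move=> k; apply: sigma_algebraCD; exact: bor.
  - move=> k l kl; rewrite subsetEset; apply: setDS => x [Xx [d dN cd]].
    by split => //; exists d => //; apply: le_lt_trans cd; rewrite ler_nat.
  - by rewrite bigcup_windowC setDv; case: pm2.
have c0 : 0 < N.+1%:R^-1 :> R by rewrite invr_gt0 ltr0n.
(* The ratio is asked to be at most [c / M] with [c = 1 / (N + 1)] and [M = k + 1]. *)
have [n uvn] := uv N _ (divr_gt0 c0 (ltr0Sn R k)).
have sub := window_sub c0 (ltr0Sn R k) uvn.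
exists (window u N N.+1%:R^-1 n); split; first exact: bor.
(* Invariance is known for windows, not for their complements, hence the passage through
   [1 - m1]. *)
- have C A := @sub_prob_setD _ seqPointed X _ lp_open_sub m1 pm1 A.
  by rewrite (C _ (bor _ _ _ _)) (op_invariant_window _ _ _ gu inv1) -(C _ (bor _ _ _ _)).
- apply: (@le_trans _ _ (m2 (window v N k.+1%:R n))).
    exact: (@sub_prob_le _ seqPointed X _ lp_open_sub m2 pm2 _ _
      (bor _ _ _ _) (bor _ _ _ _) sub).
  rewrite (op_invariant_window _ _ _ gv inv2).
  by move: m2k; rewrite setDD setIidr// => x [].
Qed.

(** * Symmetry of orthogonality, and reduction of both hypotheses to [vanishing_ratio] *)

Lemma mutually_singular_sym (m1 m2 : set (nat -> K) -> \bar R) :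
  mutually_singular nrm p m1 m2 -> mutually_singular nrm p m2 m1.
Proof.
move=> [A [BA A1 A2]]; exists (X `\` A); split => //.
  exact: sigma_algebraCD.
by rewrite setDD setIidr//; exact: (sigma_algebra_subset lp_open_sub).
Qed.

Lemma orthogonal_sym T1 T2 :
  op_orthogonal nrm p T1 T2 -> op_orthogonal nrm p T2 T1.
Proof.
by move=> ort m1 m2 *; apply: mutually_singular_sym; exact: ort.
Qed.

Let nrm_wratio u v n : good_weight nrm v ->
  nrm (wprod u n) = wratio nrm u v n * nrm (wprod v n).
Proof. by move=> gv; rewrite -nrmM divfK// wprod_neq0. Qed.

Lemma liminf_vanishing_ratio u v : good_weight nrm v ->
  hyp_liminf nrm u v -> vanishing_ratio u v.
Proof.
move=> gv inf0 N e e0; apply: contrapT => H.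
suff : (e%:E <= 0 :> \bar R)%E by rewrite leNgt lte_fin e0.
(* If no [n] worked, every maximum would be at least [e], hence so would every tail infimum and
   their limit. *)
rewrite -(inf0 N) limn_einf_lim; apply: lime_ge; first exact: is_cvg_einfs.
apply: nearW => n; apply: le_ereal_inf_tmp => _ [k _ <-]; rewrite lee_fin.
rewrite leNgt; apply/negP => lt_e; apply: H; exists k => d dN.
rewrite (nrm_wratio _ _ gv) ler_wpM2r//; apply: le_trans (ltW lt_e).
by apply: (le_bigmax_seq 0 d xpredT (fun d => wratio nrm u v (k + d)));
  rewrite ?mem_index_iota.
Qed.

Lemma limsup_vanishing_ratio u v : good_weight nrm v ->
  hyp_limsup nrm u v -> vanishing_ratio v u.
Proof.
move=> gv supy N e e0; apply: contrapT => H.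
(* A minimum above [1 / e] would put every inverse ratio of the window below [e]; otherwise all tail
   suprema are at most [1 / e]. *)
suff : (+oo <= (e^-1)%:E :> \bar R)%E by [].
rewrite -(supy N) limn_esup_lim; apply: lime_le; first exact: is_cvg_esups.
apply: nearW => n; apply: ge_ereal_sup => _ [k _ <-]; rewrite lee_fin.
rewrite leNgt; apply/negP => lt_e; apply: H; exists k => d dN.
rewrite (nrm_wratio u _ gv) mulrA ler_peMl// -ler_pdivrMl// mulr1.
apply: (le_trans (ltW lt_e)).
by apply: (ge_bigmin_seq _ d xpredT (fun d => wratio nrm u v (k + d)));
  rewrite ?mem_index_iota.
Qed.

Lemma bshift_orthogonal u v : good_weight nrm u -> good_weight nrm v ->
  hyp_liminf nrm u v \/ hyp_limsup nrm u v ->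
  op_orthogonal nrm p (bshift u) (bshift v).
Proof.
move=> gu gv [inf0|supy].
  exact/orthogonal_of_vanishing_ratio/liminf_vanishing_ratio.
exact/orthogonal_sym/orthogonal_of_vanishing_ratio/limsup_vanishing_ratio.
Qed.

End WeightedShift.

(** * Real and complex absolute values *)

Lemma cmodE (R : realType) : @cmod R = @Normc.normc R.
Proof. by apply/funext => -[a b]. Qed.

(* Real scalars (first conjunct) and complex scalars (second conjunct). *)
Theorem theorem3p10 (R : realType) (p : R) (hp : 1 <= p) :
  (forall u v : nat -> R,
     good_weight (fun x : R => `|x|) u -> good_weight (fun x : R => `|x|) v ->
     (hyp_liminf (fun x : R => `|x|) u v \/ hyp_limsup (fun x : R => `|x|) u v) ->
     op_orthogonal (fun x : R => `|x|) p (bshift u) (bshift v)) /\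
  (forall u v : nat -> R[i],
     good_weight (@cmod R) u -> good_weight (@cmod R) v ->
     (hyp_liminf (@cmod R) u v \/ hyp_limsup (@cmod R) u v) ->
     op_orthogonal (@cmod R) p (bshift u) (bshift v)).
Proof.
split=> u v.
  apply: bshift_orthogonal => //; [exact: normr_eq0|exact: normrM|
    exact: ler_normD|exact: normrN].
apply: bshift_orthogonal => //; rewrite cmodE.
- by move=> [a b]; exact: sqrtr_ge0.
- move=> x; apply/eqP/eqP => [/Normc.eq0_normc//|->]; exact: Normc.normc0.
- exact: Normc.normcM.
- exact: (@le_normcD R).
- exact: (@normcN R).
Qed.
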